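(* There exist point sets $U_n\subset\mathbb{R}^2$ of size $22n^{3/2}+\Theta(n)$ such that for every partial order $(A,\le)$ of width two with $|A|=n$ there is an injective map $f:A\to U_n$ with $a\le b$ if and only if both coordinates of $f(b)$ are at least the corresponding coordinates of $f(a)$ (i.e. $U_n$ is a universal point set for dominance drawings of the Hasse diagrams of $n$-element width-two partial orders).
   Context: The width of a partial order is the maximum size of an antichain (a set of pairwise incomparable elements). *)

(* Defs.v *)
From mathcomp Require Import all_boot all_order all_algebra.
From mathcomp Require Import reals.
Set Implicit Arguments. Unset Strict Implicit. Unset Printing Implicit Defensive.
Import Order.TTheory GRing.Theory Num.Theory.

Definition is_partial_order (T : finType) (le : rel T) : Prop :=
  reflexive le /\ antisymmetric le /\ transitive le.

Definition antichain (T : finType) (le : rel T) (S : {set T}) : bool :=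
  [forall x in S, forall y in S, (x != y) ==> (~~ le x y && ~~ le y x)].

Definition width (T : finType) (le : rel T) : nat :=
  \max_(S : {set T} | antichain le S) #|S|.

Definition dominated (R : realType) (p q : R * R) : bool :=
  ((p.1 <= q.1) && (p.2 <= q.2))%R.

(* Main.v *)
Require Import Defs.
From mathcomp Require Import all_boot all_order all_algebra.
From mathcomp Require Import reals boolp zify lra.
Set Implicit Arguments. Unset Strict Implicit. Unset Printing Implicit Defensive.
Import Order.TTheory GRing.Theory Num.Theory.

(** A width-two order is the union of two chains, hence has a realizer by two
    linear extensions x and y, in which no three elements are x-increasing and
    y-decreasing.  Put m = ceil (sqrt n).  Starting from the empty set, take
    alternately x- and y-initial segments, each containing the previous one
    and, unless it is everything, at least m more elements.  The minimal next
    initial segment adds a chain, since all added elements are incomparable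
    to a single old one; so one can arrange that every block of added elements
    either has at most m elements (light) or is a chain (heavy), and there are
    at most m blocks.

    The blocks are drawn in consecutive cells of a staircase, where each cell
    shares its columns with one neighbour and its rows with the other.  A cell
    offers a diagonal of 3 m ^ 2 + 1 points for a heavy block and the
    (3 m + 1) x (3 m + 1) grid of the points with both coordinates divisible by
    m for a light one.  Along a run of heavy blocks all cells use the same
    coordinates; the run meets at most two light blocks, one at each end, so
    giving m units to each of their at most 2 m elements and one unit to each
    heavy element uses at most 2 m ^ 2 + n <= 3 m ^ 2 units.  This gives about
    12 n ^ (3/2) points, and the set is padded to the required size. *)

(** * Realizers of width-two orders *)

Section Realizer.
Variables (T : finType) (le : rel T).
Hypotheses (le_refl : reflexive le) (le_anti : antisymmetric le)
           (le_trans : transitive le).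

Definition cmp a b := le a b || le b a.

Lemma cmpC a b : cmp a b = cmp b a.
Proof. by rewrite /cmp orbC. Qed.

Hypothesis width2 : forall a b c, [|| cmp a b, cmp a c | cmp b c].

Lemma maximal_exists (P : pred T) :
  (exists x, P x) -> exists2 x, P x & forall y, P y -> le x y -> y = x.
Proof.
case=> x0 Px0.
case: (@arg_maxnP _ x0 P (fun x => #|[set z | le z x]|) Px0) => x Px xmax.
exists x => // y Py xy; apply/eqP/negPn/negP => neq.
have /= := xmax y Py; rewrite leqNgt => /negP; apply.
apply/proper_card/properP; split.
  by apply/subsetP => z; rewrite !inE => /le_trans; apply.
exists y; rewrite !inE ?le_refl //; apply/negP => yx.
by case/eqP: neq; apply: le_anti; rewrite yx xy.
Qed.

(* Galvin's proof of Dilworth's theorem for two chains. *)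
Lemma two_chains (S : {set T}) :
  exists A : {set T}, {in S &, forall a b, (a \in A) = (b \in A) -> cmp a b}.
Proof.
have [k leSk] := ubnP #|S|; elim: k S leSk => // k IH S leSk.
have [->|[a0 a0S]] := set_0Vmem S.
  by exists set0 => a b; rewrite inE.
have [|a aS amax] := @maximal_exists (mem S); first by exists a0.
have {IH}[|A HA] := IH (S :\ a).
  by move: leSk; rewrite (cardsD1 a); have -> : a \in S by [].
have [/existsP[u /existsP[v /and3P[uS vS uv]]]|noinc] :=
  boolP [exists u, exists v, [&& u \in S :\ a, v \in S :\ a & ~~ cmp u v]]; last first.
  have HS u v : u \in S :\ a -> v \in S :\ a -> cmp u v.
    move=> uS vS; apply/negPn/negP => uv; move/negP: noinc; apply.
    by apply/existsP; exists u; apply/existsP; exists v; rewrite uS vS.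
  exists [set a] => u v uS vS; rewrite !inE.
  have [->|ua] := eqVneq u a; have [->|va] := eqVneq v a => // _.
    by rewrite /cmp le_refl.
  by apply: HS; rewrite !inE ?ua ?va.
(* [P c] selects the elements of chain [c] that have an incomparable partner; [X c] will be the
   greatest of them. *)
pose P c := [pred x in S :\ a | ((x \in A) == c) && [exists y in S :\ a, ~~ cmp x y]].
have opp x y : x \in S :\ a -> y \in S :\ a -> ~~ cmp x y -> (y \in A) = ~~ (x \in A).
  move=> xS yS xy; have := HA x y xS yS.
  by case: (x \in A); case: (y \in A) => // /(_ erefl) H; rewrite H in xy.
have inP x y : x \in S :\ a -> y \in S :\ a -> ~~ cmp x y -> P (x \in A) x.
  by move=> xS yS xy; rewrite /= xS eqxx; apply/existsP; exists y; rewrite yS.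
have Pex c : exists x, P c x.
  have Pu := inP _ _ uS vS uv.
  have vu : ~~ cmp v u by rewrite cmpC.
  have Pv := inP _ _ vS uS vu.
  have := opp _ _ uS vS uv; case: (eqVneq c (u \in A)) => [-> _|cu e]; first by exists u.
  by exists v; suff -> : c = (v \in A) by []; move: cu; rewrite e; case: c; case: (u \in A).
have Xex c : exists x, P c x /\ forall y, P c y -> le y x.
  have [x Px xmax] := maximal_exists (Pex c).
  exists x; split=> // y Py; have [/andP[xS _] /andP[yS _]] := (Px, Py).
  have := HA x y xS yS; move: (Px) (Py) => /= /and3P[_ /eqP-> _] /and3P[_ /eqP-> _].
  move=> /(_ erefl); rewrite /cmp; case/orP=> // xy.
  by rewrite (xmax y) ?le_refl // /= yS.
have {Xex Pex}[X HX] := choice Xex.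
have XS c : X c \in S :\ a by have [/andP[]] := HX c.
have XA c : (X c \in A) = c by have [/and3P[_ /eqP]] := HX c.
(* If [X c] were below [X (~~ c)], then the partner of [X (~~ c)], which lies in chain [c] and hence
   below [X c], would be comparable to [X (~~ c)]. *)
have XX : ~~ cmp (X true) (X false).
  have nle c : ~~ le (X c) (X (~~ c)).
    have [/and3P[_ _ /existsP[y /andP[yS xy]]] _] := HX (~~ c).
    have yx : ~~ cmp y (X (~~ c)) by rewrite cmpC.
    have Py := inP _ _ yS (XS (~~ c)) yx.
    rewrite (opp _ _ (XS (~~ c)) yS xy) XA negbK in Py.
    apply/negP => XX; move/negP: yx; apply; rewrite /cmp.
    by rewrite (le_trans ((HX c).2 _ Py) XX).
  by rewrite /cmp negb_or (nle true) (nle false).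
have [c Xa] : exists c, le (X c) a.
  have Xcmp c : cmp a (X c) -> le (X c) a.
    case/orP => // aX; have /setD1P[Xna XcS] := XS c.
    by rewrite (amax _ XcS aX) eqxx in Xna.
  have := width2 a (X true) (X false); rewrite (negbTE XX) orbF.
  by case/orP=> /Xcmp; [exists true | exists false].
(* In an incomparable pair of [S :\ a] the member from chain [c] lies below [X c], so removing the
   new chain leaves no such pair. *)
exists (a |: [set z in S :\ a | ((z \in A) == c) && le z (X c)]) => u1 v1 u1S v1S.
rewrite !in_set !in_set1.
have [->|u1a] := eqVneq u1 a; have [->|v1a] := eqVneq v1 a => //=.
- by rewrite /cmp le_refl.
- by move=> /esym/and3P[_ _ /le_trans/(_ Xa)]; rewrite /cmp => ->; rewrite orbT.
- by move=> /and3P[_ _ /le_trans/(_ Xa)]; rewrite /cmp => ->.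
have u1S' : u1 \in S :\ a by rewrite !inE u1a.
have v1S' : v1 \in S :\ a by rewrite !inE v1a.
rewrite u1S v1S /= => E; apply/negPn/negP => uv1.
have vu1 : ~~ cmp v1 u1 by rewrite cmpC.
have e := opp _ _ u1S' v1S' uv1.
have Pu := inP _ _ u1S' v1S' uv1; have Pv := inP _ _ v1S' u1S' vu1.
move: E; have [ec|nc] := eqVneq (u1 \in A) c.
  rewrite ec in Pu; rewrite (HX c).2 // e ec.
  by case: (c).
have ec : (v1 \in A) = c by move: nc; rewrite e; case: (u1 \in A); case: (c).
by rewrite ec eqxx /= (HX c).2 // -ec.
Qed.

Variable A : {set T}.
Hypothesis chainA : forall a b, (a \in A) = (b \in A) -> cmp a b.

(* The two linear extensions of a realizer: incomparable pairs are ordered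
   with the elements of A first, respectively last. *)
Definition lext c a b := le a b || (~~ le b a && ((a \in A) == c)).

Lemma lext_refl c : reflexive (lext c).
Proof. by move=> a; rewrite /lext le_refl. Qed.

Lemma lext_total c : total (lext c).
Proof.
move=> a b; rewrite /lext; have := @chainA a b; rewrite /cmp.
case: (le a b); case: (le b a) => //=.
by case: (a \in A); case: (b \in A); case: c => // /(_ erefl).
Qed.

Lemma lext_anti c : antisymmetric (lext c).
Proof.
move=> a b; rewrite /lext; have := @chainA a b; have := @le_anti a b; rewrite /cmp.
case: (le a b); case: (le b a) => /= an ch.
- by rewrite an.
- by [].
- by [].
by case: (a \in A) ch; case: (b \in A); case: c => // /(_ erefl).
Qed.

(** The delicate case is [u] below [v] with [v], [w] incomparable: if [u], [w] are incomparable too,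
    then [u] and [v] both lie in the chain that misses [w]. *)
Lemma lext_trans c : transitive (lext c).
Proof.
move=> v u w; rewrite /lext.
case/orP=> [uv|/andP[vu uc]]; case/orP=> [vw|/andP[wv vc]].
- by rewrite (le_trans uv vw).
- have wu : ~~ le w u by apply: contra wv => /le_trans; apply.
  rewrite wu /=; case: (boolP (le u w)) => //= uw.
  have := @chainA u w; have := @chainA v w; rewrite /cmp (negbTE wu) (negbTE uw) (negbTE wv).
  case: (boolP (le v w)) => [/(le_trans uv)|_]; first by rewrite (negbTE uw).
  move=> Hv Hu; apply/negPn/negP => uc.
  have [e|e] := eqVneq (u \in A) (w \in A); first by have := Hu e.
  suff e' : (v \in A) = (w \in A) by have := Hv e'.
  by move: vc uc e; case: (u \in A); case: (v \in A); case: (w \in A); case: c.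
- have wu : ~~ le w u by apply: contra vu; apply: le_trans.
  by rewrite wu uc orbT.
- have := @chainA u v; rewrite (eqP uc) (eqP vc) => /(_ erefl).
  rewrite /cmp (negbTE vu) orbF => uv.
  have wu : ~~ le w u by apply: contra wv => /le_trans; apply.
  by rewrite wu eqxx orbT.
Qed.

Lemma lext_le a b : le a b = lext true a b && lext false a b.
Proof. by rewrite /lext; case: (le a b); case: (le b a); case: (a \in A). Qed.

Definition lrank c b := #|[set a | lext c a b]|.

Lemma lrankE c a b : lext c a b = (lrank c a <= lrank c b).
Proof.
have mono x y : lext c x y -> lrank c x <= lrank c y.
  move=> xy; apply/subset_leq_card/subsetP => z; rewrite !inE => zx.
  exact: lext_trans zx xy.
apply/idP/idP => [/mono//|]; case: (boolP (lext c a b)) => //= nab.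
rewrite leqNgt => /negP; case.
have ba : lext c b a by have := lext_total c a b; rewrite (negbTE nab).
apply/proper_card/properP; split.
  by apply/subsetP => z; rewrite !inE => /lext_trans; apply.
by exists a; rewrite !inE ?lext_refl.
Qed.

End Realizer.

Lemma realizer (T : finType) (le : rel T) :
  reflexive le -> antisymmetric le -> transitive le ->
  (forall a b c, [|| cmp le a b, cmp le a c | cmp le b c]) ->
  exists r : bool -> T -> nat, (forall c, injective (r c)) /\
    forall a b, le a b = (r true a <= r true b) && (r false a <= r false b).
Proof.
move=> le_refl le_anti le_trans width2.
have [A HA] := two_chains le_refl le_anti le_trans width2 setT.
have chainA a b : (a \in A) = (b \in A) -> cmp le a b.
  by apply: HA; rewrite inE.
exists (lrank le A); split=> [c a b eab|a b].
  by apply: (lext_anti le_anti chainA (c := c)); rewrite !lrankE // eab leqnn.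
by rewrite (lext_le _ A) !lrankE.
Qed.

(** * Merging two sequences that agree on their common elements *)

Section Amalgam.
Variable T : eqType.

Fixpoint amalgam (s t : seq T) : seq T :=
  if s is x :: s' then
    if x \in t then take (index x t) t ++ x :: amalgam s' (drop (index x t).+1 t)
    else x :: amalgam s' t
  else t.

Lemma amalgamP s t : uniq s -> uniq t ->
  [seq x <- s | x \in t] = [seq x <- t | x \in s] ->
  [/\ uniq (amalgam s t), amalgam s t =i s ++ t,
      subseq s (amalgam s t) & subseq t (amalgam s t)].
Proof.
elim: s t => [|x s IH] t; first by move=> _ ut _; split; rewrite ?sub0seq.
move=> /= /andP[xs us] ut; have [xt|xt] := boolP (x \in t); last first.
  move=> e; have [|uw mw sw tw] := IH t us ut.
    rewrite e; apply: eq_in_filter => y yt; rewrite inE.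
    by case: eqP => // eyx; rewrite -eyx yt in xt.
  split=> //=.
  - by rewrite uw mw mem_cat negb_or xs xt.
  - by move=> y; rewrite !inE mw.
  - by rewrite eqxx.
  - by apply: subseq_trans tw (subseq_cons _ _).
have et : t = take (index x t) t ++ x :: drop (index x t).+1 t.
  by rewrite -[LHS](cat_take_drop (index x t)) (drop_nth x) ?index_mem // nth_index.
move: (take _ t) (drop _ t) et => t1 t2 et; rewrite {t}et in xt ut *.
move: ut; rewrite cat_uniq /= => /and3P[u1]; rewrite negb_or => /andP[xt1 dis] /andP[xt2 u2].
rewrite filter_cat /= inE eqxx /=.
(* No element of [s] precedes [x] in [t], since the first common element of [t] must be [x]
   itself. *)
case E: [seq y <- t1 | y \in x :: s] => [|z z1] /=; last first.
  have : z \in [seq y <- t1 | y \in x :: s] by rewrite E inE eqxx.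
  by rewrite mem_filter => /andP[_ zt1] [exz]; rewrite exz zt1 in xt1.
have t1s y : y \in t1 -> y \in s = false.
  move=> yt1; apply/negP => ys; have : y \in [seq y <- t1 | y \in x :: s].
    by rewrite mem_filter yt1 inE ys orbT.
  by rewrite E.
case=> e; have [|uw mw sw tw] := IH t2 us u2.
  rewrite -(eq_in_filter (a1 := fun y => y \in t1 ++ x :: t2)); last first.
    move=> y ys; rewrite mem_cat inE; case: (boolP (y \in t1)) => [/t1s|_]; first by rewrite ys.
    by case: eqP => // eyx; rewrite -eyx ys in xs.
  rewrite e; apply: eq_in_filter => y yt2; rewrite inE.
  by case: eqP => // eyx; rewrite -eyx yt2 in xt2.
split.
- rewrite cat_uniq u1 /= negb_or xt1 uw mw mem_cat negb_or xs xt2 /= andbT.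
  apply/hasPn => y; rewrite mw mem_cat => /orP[ys|yt2].
    by apply/negP => /t1s; rewrite ys.
  by apply/negP => yt1; move/hasPn: dis => /(_ _ yt2); rewrite yt1.
- move=> y; rewrite !(mem_cat, inE) mw mem_cat.
  by case: (y == x); case: (y \in t1); case: (y \in t2); case: (y \in s).
- apply: (subseq_trans _ (suffix_subseq _ _)); by rewrite /= eqxx.
by apply: cat_subseq => //=; rewrite eqxx.
Qed.

End Amalgam.

(** * The staircase of cells *)

Definition cell m :=
  [seq (p, p) | p <- iota 0 (3 * (m * m)).+1] ++
  [seq (i * m, k * m) | i <- iota 0 (3 * m).+1, k <- iota 0 (3 * m).+1].

(** Intervals of length [M] with even number lie on the horizontal axis, the odd ones on the
    vertical axis; [c.1] is always the offset in interval [j] and [c.2] the one in interval [j.+1],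
    hence the swap. *)
Definition place M j (c : nat * nat) :=
  if odd j then (j.+1 * M + c.2, j * M + c.1) else (j * M + c.1, j.+1 * M + c.2).

Definition staircase m :=
  [seq place (3 * (m * m)).+1 j c | j <- iota 0 m, c <- cell m].

Lemma size_staircase m : size (staircase m) <= 20 * (m * (m * m)).
Proof.
rewrite size_allpairs size_cat size_map size_allpairs !size_iota.
(* The exact size is m * (12 m ^ 2 + 6 m + 2). *)
by case: m => // m; nia.
Qed.

(** * Alternating initial segments *)

Section Layout.
Variables (T : finType) (m : nat) (r : bool -> T -> nat).
Hypotheses (m_gt0 : 0 < m) (cardT : #|T| <= m * m).
Hypothesis r_inj : forall b, injective (r b).
Hypothesis no321 : forall b u v w, r b u < r b v -> r b v < r b w ->
  r (~~ b) w < r (~~ b) v -> r (~~ b) v < r (~~ b) u -> False.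

Definition initial b (D : {set T}) :=
  forall u v, r b u <= r b v -> v \in D -> u \in D.

Definition next_initial b (D D' : {set T}) :=
  [/\ D \subset D', initial (~~ b) D', D' = setT \/ #|D| + m <= #|D'|
    & #|D' :\: D| <= m \/
      {in D' :\: D &, forall u v, r b u < r b v -> r (~~ b) u < r (~~ b) v}].

Lemma next_initial_exists b D : initial b D -> exists D', next_initial b D D'.
Proof.
move=> Db; pose seg t := [set u | r (~~ b) u < t].
have segI t : initial (~~ b) (seg t).
  by move=> u v uv; rewrite !inE; apply: leq_ltn_trans.
have cardSeg t : D \subset seg t -> #|seg t| = #|D| + #|seg t :\: D|.
  by move=> sD; rewrite -(cardsID D (seg t)) (setIidPr sD).
pose t0 := \max_(u in D) (r (~~ b) u).+1.
have Dt0 t : t0 <= t -> D \subset seg t.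
  move=> le_t; apply/subsetP => u uD; rewrite inE; apply: leq_trans le_t.
  exact: (@leq_bigmax_cond _ (mem D) (fun u => (r (~~ b) u).+1)).
have [heavy|light] := ltnP m #|seg t0 :\: D|.
  exists (seg t0); split=> //; first exact: Dt0.
    by right; rewrite cardSeg ?Dt0 // leq_add2l ltnW.
  right=> u v; rewrite !inE => /andP[uD ut] /andP[vD vt] uv.
  have [d0 d0D] : exists d, d \in D.
    apply/set0Pn/eqP => D0; move: ut; rewrite /t0 D0 big_set0 //.
  (* The last element [d] of [D] for [r (~~ b)] precedes all new elements for [r b] and follows them
     for [r (~~ b)], so an inverted pair of them would complete a pattern excluded by [no321]. *)
  have [d dD Ed] : exists2 d, d \in D & t0 = (r (~~ b) d).+1.
    have D0 : 0 < #|D| by apply/card_gt0P; exists d0.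
    by have [d] := eq_bigmax_cond (fun u => (r (~~ b) u).+1) D0; exists d.
  have ltb w : w \notin D -> r b d < r b w.
    by move=> wD; rewrite ltnNge; apply: contra wD => /Db; apply.
  rewrite ltnNge; apply/negP; rewrite leq_eqVlt => /orP[/eqP/r_inj euv|vu].
    by rewrite euv ltnn in uv.
  have ud : r (~~ b) u < r (~~ b) d.
    rewrite Ed ltnS leq_eqVlt in ut; case/orP: ut => // /eqP/r_inj eud.
    by rewrite eud dD in uD.
  exact: (no321 (ltb u uD) uv vu ud).
have [small|large] := leqP #|~: D| m.
  exists setT; split; [exact: subsetT | by move=> u v; rewrite !inE | by left | left].
  by rewrite setTD.
have ext : exists t, (t0 <= t) && (m <= #|seg t :\: D|).
  exists (maxn t0 (\max_u (r (~~ b) u).+1)); rewrite leq_maxl /=.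
  apply: leq_trans (ltnW large) _; apply/subset_leq_card/subsetP => u.
  rewrite !inE => ->; rewrite /= leq_max; apply/orP; right.
  exact: (@leq_bigmax _ (fun u => (r (~~ b) u).+1)).
have [t /andP[le_t mt] tmin] := ex_minnP ext.
exists (seg t); split=> //; first exact: Dt0.
  by right; rewrite cardSeg ?Dt0 // leq_add2l.
(* If [t] exceeds [t0], the threshold just below it yields fewer than [m] new elements, and raising
   it by one adds at most one element because ranks are injective. *)
left; have [->//|ne] := eqVneq t t0.
case: t le_t mt tmin ne => [|t] le_t mt tmin ne.
  by move: ne le_t; rewrite leqn0 eq_sym => /negbTE->.
have lt : #|seg t :\: D| < m.
  have t0t : t0 <= t by move: le_t; rewrite leq_eqVlt eq_sym (negbTE ne).
  by rewrite ltnNge; apply/negP => mt'; have := tmin t; rewrite t0t mt' ltnn => /(_ isT).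
apply: leq_trans lt; have [/existsP[x /eqP rx]|nx] := boolP [exists x, r (~~ b) x == t].
  rewrite -(add1n #|_|) -(cards1 x); apply: leq_trans (leq_card_setU _ _).
  apply/subset_leq_card/subsetP => u; rewrite !inE ltnS leq_eqVlt.
  by case/andP=> -> /orP[/eqP|->]; rewrite ?orbT // -rx => /r_inj ->; rewrite eqxx.
apply: leqW; apply/subset_leq_card/subsetP => u; rewrite !inE ltnS leq_eqVlt.
case/andP=> -> /orP[/eqP ru|->//]; case/negP: nx.
by apply/existsP; exists u; rewrite ru.
Qed.

Lemma initial_chain_exists : exists D : nat -> {set T},
  D 0 = set0 /\ forall j, next_initial (~~ odd j) (D j) (D j.+1).
Proof.
(* The step is made total, with the arbitrary value [set0] off initial sets, so that [choice]
   applies. *)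
have step (x : bool * {set T}) : exists D', initial x.1 x.2 -> next_initial x.1 x.2 D'.
  have [/next_initial_exists[D' HD']|] := pselect (initial x.1 x.2); last by exists set0.
  by exists D'.
have {step}[g Hg] := choice step.
pose D := fix D j := if j is j'.+1 then g (~~ odd j', D j') else set0.
have HD j : initial (~~ odd j) (D j) /\ next_initial (~~ odd j) (D j) (D j.+1).
  elim: j => [|j [_ IH]]; last first.
    have I : initial (~~ odd j.+1) (D j.+1) by case: IH.
    by split=> //; exact: (Hg (_, _)).
  have I : initial true set0 by move=> u v; rewrite !inE.
  by split=> //; exact: (Hg (_, _)).
by exists D; split=> // j; case: (HD j).
Qed.

(** * Blocks, links and runs *)

Variable D : nat -> {set T}.
Hypotheses (D0 : D 0 = set0)
           (Dnext : forall j, next_initial (~~ odd j) (D j) (D j.+1)).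

Definition block j := D j.+1 :\: D j.

Definition light j := #|block j| <= m.

Lemma D_mono i j : i <= j -> D i \subset D j.
Proof.
elim: j => [|j IH]; first by rewrite leqn0 => /eqP->.
rewrite leq_eqVlt => /orP[/eqP->//|/IH sub]; apply: subset_trans sub _.
by case: (Dnext j).
Qed.

Lemma D_initial j : initial (odd j) (D j.+1).
Proof. by have [_ H _ _] := Dnext j; rewrite negbK in H. Qed.

(** Each step that does not exhaust [T] adds at least [m] elements, and [T] has at most [m * m]. *)
Lemma D_full : D m = setT.
Proof.
have H j : D j = setT \/ j * m <= #|D j|.
  elim: j => [|j IH]; first by right.
  have [sub _ [full|grow] _] := Dnext j; first by left.
  case: IH => [full|IH]; first by left; apply/eqP; rewrite eqEsubset subsetT -full.
  by right; rewrite mulSn addnC; apply: leq_trans grow; rewrite leq_add2r.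
case: (H m) => // full; apply/eqP; rewrite eqEcard subsetT cardsT.
exact: leq_trans full.
Qed.

Definition bindex u := find (fun j => u \in D j.+1) (iota 0 m).

Lemma bindexP u : bindex u < m /\ u \in block (bindex u).
Proof.
have hasu : has (fun j => u \in D j.+1) (iota 0 m).
  apply/hasP; exists m.-1; first by rewrite mem_iota /= add0n prednK.
  by rewrite prednK // D_full inE.
have lt : bindex u < m by rewrite -[X in _ < X](size_iota 0 m) -has_find.
split=> //; rewrite /block inE.
have := nth_find 0 hasu; rewrite -/(bindex u) nth_iota // add0n => ->; rewrite andbT.
case E: (bindex u) => [|k]; first by rewrite D0 inE.
have kb : k < bindex u by rewrite E.
by have := before_find 0 kb; rewrite nth_iota ?add0n ?(ltn_trans kb) // => ->.
Qed.

Lemma bindex_uniq u j : u \in block j -> bindex u = j.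
Proof.
rewrite inE => /andP[uj uj1]; have [_] := bindexP u; rewrite inE => /andP[ub ub1].
have [lt|gt|//] := ltngtP (bindex u) j.
  by rewrite (subsetP (D_mono lt)) in uj.
by rewrite (subsetP (D_mono gt)) in ub.
Qed.

(* The union of the blocks j - 1 and j, which share an interval of the
   axis [odd j]. *)
Definition link j := D j.+1 :\: D j.-1.

Definition link_seq j :=
  sort (fun u v => r (odd j) u <= r (odd j) v) (enum (link j)).

Let ler b : rel T := fun u v => r b u <= r b v.

Lemma ler_trans b : transitive (ler b).
Proof. by move=> y x z; apply: leq_trans. Qed.

Lemma ler_anti b : antisymmetric (ler b).
Proof. by move=> x y; rewrite -eqn_leq => /eqP/r_inj. Qed.

Lemma mem_link_seq j u : (u \in link_seq j) = (u \in link j).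
Proof. by rewrite mem_sort mem_enum. Qed.

Lemma link_seq_uniq j : uniq (link_seq j).
Proof. by rewrite sort_uniq enum_uniq. Qed.

Lemma link_seq_sorted j : sorted (ler (odd j)) (link_seq j).
Proof. by apply: sort_sorted => u v; apply: leq_total. Qed.

Lemma block_link j u : u \in block j -> (u \in link j) && (u \in link j.+1).
Proof.
rewrite !inE /= => /andP[uj uj1]; rewrite uj uj1 (subsetP (D_mono (leqnSn j.+1)) _ uj1) !andbT.
by apply: contra uj; apply/subsetP/D_mono/leq_pred.
Qed.

(* A maximal run of consecutive heavy blocks uses one common order, extending
   the orders of all its links: a heavy block is a chain, so its two links
   agree on it and their orders amalgamate. *)
Fixpoint run_rec k j :=
  if k is k'.+1 then
    if light j then link_seq j else amalgam (link_seq j) (run_rec k' j.+1)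
  else link_seq j.

Definition run j := run_rec (m - j) j.

Definition light_elt u := light (bindex u).

Lemma count_le_card (p : pred T) (s : seq T) (A : {set T}) :
  uniq s -> {in s, forall u, p u -> u \in A} -> count p s <= #|A|.
Proof.
move=> us H; rewrite -size_filter cardE.
apply: uniq_leq_size; first exact: filter_uniq.
by move=> u; rewrite mem_filter mem_enum => /andP[pu /H]; apply.
Qed.

(** The fuel [m - j] suffices: blocks from index [m] on are empty, hence light. *)
Lemma runE j : run j = if light j then link_seq j else amalgam (link_seq j) (run j.+1).
Proof.
rewrite /run; case: (ltnP j m) => [lt|ge].
  by rewrite -(prednK (n := m - j)) ?subn_gt0 // subnS.
rewrite (_ : m - j = 0); last by apply/eqP.
suff -> : light j by [].
rewrite /light /block (_ : D j.+1 :\: D j = set0) ?cards0 //.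
apply/eqP; rewrite setD_eq0 (subset_trans (subsetT _)) // -D_full.
exact: D_mono.
Qed.

(** By induction from the last block. In the final clause, the light elements outside [D j] all lie
    in the single light block that ends the run. *)
Lemma run_spec j :
  [/\ uniq (run j), subseq (link_seq j) (run j),
      ~~ light j -> subseq (run j.+1) (run j),
      {in run j, forall u, u \notin D j.-1}
    & count (fun u => light_elt u && (u \notin D j)) (run j) <= m].
Proof.
have [k] := ubnP (m - j); elim: k j => // k IH j lek.
rewrite runE; case: (boolP (light j)) => [lj|hj].
  split=> //; first exact: link_seq_uniq.
    by move=> u; rewrite mem_link_seq !inE => /andP[].
  apply: leq_trans lj; apply: count_le_card; first exact: link_seq_uniq.
  by move=> u; rewrite mem_link_seq !inE => /andP[_ ->] /andP[_ ->].
have ltj : j < m.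
  rewrite ltnNge; apply: contra hj => lemj; rewrite /light (_ : block j = set0) ?cards0 //.
  by apply/eqP; rewrite setD_eq0 (subset_trans (subsetT _)) // -D_full D_mono.
have [|uF sF _ nF cF] := IH j.+1; first by lia.
have memF u : u \in link_seq j -> u \in run j.+1 -> u \in block j.
  by rewrite mem_link_seq !inE => /andP[_ ->] /nF /= ->.
have blockF u : u \in block j -> (u \in link_seq j) && (u \in run j.+1).
  move=> /block_link; rewrite mem_link_seq => /andP[-> ] /= ul.
  by apply: (mem_subseq sF); rewrite mem_link_seq.
have comm1 : [seq u <- link_seq j | u \in run j.+1] = [seq u <- link_seq j | u \in block j].
  apply: eq_in_filter => u ul; apply/idP/idP => [/(memF u ul)//|/blockF/andP[]//].
have comm2 : [seq u <- run j.+1 | u \in link_seq j] = [seq u <- link_seq j.+1 | u \in block j].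
  have /subseq_uniqP := sF; move=> /(_ uF) ->.
  rewrite -filter_predI; apply: eq_in_filter => u ul /=.
  apply/idP/andP => [/memF/(_ ul) ub|[/blockF/andP[]//]].
  by split=> //; rewrite mem_link_seq; case/andP: (block_link ub).
have [|uw mw sw tw] := amalgamP (link_seq_uniq j) uF.
  (* The common elements form block [j]. The two sequences sort it along opposite axes, which gives
     the same order because a heavy block is a chain. *)
  rewrite comm1 comm2; apply: (sorted_eq (leT := ler (odd j))).
  - exact: ler_trans.
  - exact: ler_anti.
  - by apply: sorted_filter (link_seq_sorted _); apply: ler_trans.
  - have chain : {in block j &, forall u v, r (~~ odd j) u < r (~~ odd j) v -> r (odd j) u < r (odd j) v}.
      have [_ _ _ [lj|]] := Dnext j; first by rewrite /light lj in hj.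
      by rewrite negbK.
    apply: (@sub_in_sorted _ (mem (block j)) (ler (~~ odd j))).
    + move=> u v ub vb /=; rewrite /ler leq_eqVlt => /orP[/eqP/r_inj->//|/chain lt].
      by apply: ltnW; apply: lt.
    + by apply/allP => u; rewrite mem_filter => /andP[].
    + by apply: sorted_filter (link_seq_sorted j.+1); apply: ler_trans.
  - apply: uniq_perm; rewrite ?filter_uniq ?link_seq_uniq // => u.
    rewrite !mem_filter !mem_link_seq; apply: andb_id2l => /block_link.
    by case/andP=> -> ->.
have sub u : u \in D j.-1 -> u \in D j by apply/subsetP/D_mono/leq_pred.
split=> //.
  move=> u; rewrite mw mem_cat => /orP[|/nF]; last by apply: contra => /sub.
  by rewrite mem_link_seq !inE => /andP[].
have nb u : light_elt u -> u \notin block j.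
  by move=> lu; apply/negP => /bindex_uniq ub; rewrite /light_elt ub (negbTE hj) in lu.
apply: leq_trans cF; rewrite -!size_filter; apply: uniq_leq_size; first exact: filter_uniq.
move=> u; rewrite !mem_filter mw mem_cat => /andP[/andP[lu uj] um].
have uj1 : u \notin D j.+1 by have := nb u lu; rewrite inE uj.
rewrite lu uj1 /=; case/orP: um => //.
by rewrite mem_link_seq inE (negbTE uj1) andbF.
Qed.

Fixpoint run_start j :=
  if j is j'.+1 then if light j' then j else run_start j' else 0.

Definition run_order j := run (run_start j).

(** This puts a heavy block on the diagonal of its cell: both of its links read their positions off
    one order. *)
Lemma run_order_heavy j : ~~ light j -> run_order j.+1 = run_order j.
Proof. by rewrite /run_order /= => /negbTE->. Qed.

Lemma run_order_uniq j : uniq (run_order j).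
Proof. by case: (run_spec (run_start j)). Qed.

Lemma link_run_order j : subseq (link_seq j) (run_order j).
Proof.
have [_ /subseq_trans-> //] := run_spec j.
elim: j => // j IH; rewrite /run_order /=; case: ifPn => // hj.
by have [_ _ /(_ hj)/subseq_trans->] := run_spec j.
Qed.

(** One [m] bounds the light block that ends the run; the other bounds the part inside [D s], which
    comes from the light block before the run or is empty when [s] is 0. *)
Lemma count_light_run_order j : count light_elt (run_order j) <= m + m.
Proof.
rewrite /run_order; set s := run_start j.
have [us _ _ ns cs] := run_spec s.
have -> : count light_elt (run s) =
    count (fun u => light_elt u && (u \in D s)) (run s) +
    count (fun u => light_elt u && (u \notin D s)) (run s).
  elim: (run s) => //= u w ->; case: (light_elt u); case: (u \in D s) => /=; lia.
apply: leq_add => //; apply: (@leq_trans #|D s :\: D s.-1|).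
  by apply: count_le_card => // u /ns; rewrite inE => -> /andP[].
have [->|[s0 ls]] : s = 0 \/ (0 < s /\ light s.-1).
- by rewrite /s; elim: j {s us ns cs} => [|j IH]; [left | rewrite /=; case: ifP => //; right].
- by rewrite D0 set0D cards0.
by move: ls; rewrite /light /block prednK.
Qed.

(** * Positions along a run and coordinates *)

Definition weight u := if light_elt u then m else 1.

Definition before s u := \sum_(v <- take (index u s) s) weight v.

(* Each element owns the integers in ]before s u, before s u + weight u]; for a
   light element exactly one of them is a multiple of m, and it is chosen. *)
Definition pos s u :=
  if light_elt u then (before s u + m) %/ m * m else (before s u).+1.

Lemma pos_gt s u : before s u < pos s u.
Proof.
rewrite /pos; case: ifP => // _.
by rewrite divnDr // divnn m_gt0 addn1 ltn_ceil.
Qed.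

Lemma pos_le s u : pos s u <= before s u + weight u.
Proof. by rewrite /pos /weight; case: ifP => _; rewrite ?leq_trunc_div ?addn1. Qed.

Lemma pos_sorted s : uniq s -> sorted (fun u v => pos s u < pos s v) s.
Proof.
case: s => // x s' ; set s := x :: s' => us.
apply/(sortedP x) => i lti; apply: leq_ltn_trans (pos_le _ _) (leq_ltn_trans _ (pos_gt _ _)).
rewrite /before !index_uniq //; last exact: ltnW.
by rewrite (take_nth x) ?(ltnW lti) // -cats1 big_cat big_seq1.
Qed.

Lemma pos_le_total s u : u \in s -> pos s u <= \sum_(v <- s) weight v.
Proof.
move=> us; apply: leq_trans (pos_le _ _) _; rewrite /before.
have e : s = take (index u s) s ++ u :: drop (index u s).+1 s.
  by rewrite -[LHS](cat_take_drop (index u s)) (drop_nth u) ?index_mem // nth_index.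
by rewrite [in leqRHS]e big_cat big_cons /= addnA leq_addr.
Qed.

Lemma run_order_pos_le j u : u \in run_order j -> pos (run_order j) u <= 3 * (m * m).
Proof.
move=> /pos_le_total/leq_trans; apply.
have -> : \sum_(v <- run_order j) weight v = count light_elt (run_order j) * m + count (predC light_elt) (run_order j).
  by elim: (run_order j) => [|v s IH]; rewrite ?big_nil // big_cons IH /weight /=; case: (light_elt v) => /=; lia.
have c1 := count_light_run_order j.
have c2 : count (predC light_elt) (run_order j) <= #|T|.
  apply: leq_trans (count_size _ _) _; rewrite -cardsT.
  by rewrite -count_predT count_le_card ?run_order_uniq // => u'; rewrite inE.
nia.
Qed.

Lemma pos_mono j u v : u \in link j -> v \in link j ->
  r (odd j) u < r (odd j) v -> pos (run_order j) u < pos (run_order j) v.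
Proof.
rewrite -!mem_link_seq => ul vl uv.
have ptr : transitive (fun u v => pos (run_order j) u < pos (run_order j) v).
  by move=> y x z; apply: ltn_trans.
have ps := subseq_sorted ptr (link_run_order j) (pos_sorted (run_order_uniq j)).
have [lt|gt|e] := ltngtP (index u (link_seq j)) (index v (link_seq j)).
- exact: (sorted_ltn_index ptr ps).
- have := sorted_ltn_index (@ler_trans _) (link_seq_sorted j) _ _ vl ul gt.
  by rewrite /ler leqNgt uv.
by rewrite -(nth_index u ul) e nth_index // ltnn in uv.
Qed.

(* The block j uses the links j and j + 1; the even one carries the abscissae,
   the odd one the ordinates. *)
Definition axis_link b j := if odd j == b then j else j.+1.

Definition coord b u := let l := axis_link b (bindex u) in
  l * (3 * (m * m)).+1 + pos (run_order l) u.

Lemma axis_linkE b j : [/\ odd (axis_link b j) = b, j <= axis_link b j & axis_link b j <= j.+1].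
Proof. by rewrite /axis_link; case: eqP => [<-|ne]; split=> //=; case: (odd j) b ne => [] [] // []. Qed.

Lemma mem_axis_link b u : u \in link (axis_link b (bindex u)).
Proof.
have [_ /block_link/andP[]] := bindexP u.
by rewrite /axis_link; case: ifP.
Qed.

Lemma mem_run_order j u : u \in link j -> u \in run_order j.
Proof. by rewrite -mem_link_seq; apply/mem_subseq/link_run_order. Qed.

(** Positions stay below the interval length, so an earlier link gives a smaller coordinate. The
    link of [u] cannot be later than that of [v]: by parity it would be later by at least 2, yet [u]
    belongs to the [b]-initial set [D lv.+1] that contains [v]. *)
Lemma coord_mono b u v : r b u < r b v -> coord b u < coord b v.
Proof.
move=> uv; rewrite /coord /=.
have [ou u1 u2] := axis_linkE b (bindex u); have [ov v1 v2] := axis_linkE b (bindex v).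
have mu := mem_axis_link b u; have mv := mem_axis_link b v.
set lu := axis_link b (bindex u) in ou u1 u2 mu *; set lv := axis_link b (bindex v) in ov v1 v2 mv *.
have pu := run_order_pos_le (mem_run_order mu).
have [lt|gt|e] := ltngtP lu lv.
- by nia.
- have [_] := bindexP u; rewrite inE => /andP[/negP nu _]; case: nu.
  have gt2 : lv.+1 <= bindex u by move: ou; rewrite -ov; lia.
  apply: (subsetP (D_mono gt2)); have := @D_initial lv; rewrite ov => /(_ u v (ltnW uv)); apply.
  have [_] := bindexP v; rewrite inE => /andP[_]; apply/subsetP/D_mono; lia.
rewrite -e ltn_add2l; apply: pos_mono; rewrite ?e ?ov //.
by rewrite -e.
Qed.

Lemma coord_mem u : (coord false u, coord true u) \in staircase m.
Proof.
set j := bindex u; have [ltj /block_link/andP[ul ul1]] := bindexP u.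
have -> : (coord false u, coord true u) =
    place (3 * (m * m)).+1 j (pos (run_order j) u, pos (run_order j.+1) u).
  by rewrite /coord /place /axis_link -/j /=; case: (odd j).
apply: allpairs_f; first by rewrite mem_iota.
have p1 := run_order_pos_le (mem_run_order ul); have p2 := run_order_pos_le (mem_run_order ul1).
rewrite -/j in p1 p2; rewrite mem_cat; case: (boolP (light j)) => lj; apply/orP.
  (* Both positions of a light element are multiples of [m] up to 3 m ^ 2, so they give a grid
     point. *)
  right; rewrite /pos /light_elt -/j lj in p1 p2 *.
  by apply: allpairs_f; rewrite mem_iota add0n ltnS /= -(leq_pmul2r m_gt0) -mulnA.
left; rewrite (run_order_heavy lj); apply: (map_f (fun p => (p, p))).
by rewrite mem_iota add0n ltnS.
Qed.

End Layout.

Lemma staircase_universal (T : finType) (m : nat) (r : bool -> T -> nat) :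
  0 < m -> #|T| <= m * m -> (forall b, injective (r b)) ->
  (forall b u v w, r b u < r b v -> r b v < r b w ->
    r (~~ b) w < r (~~ b) v -> r (~~ b) v < r (~~ b) u -> False) ->
  exists f : bool -> T -> nat,
    (forall u, (f false u, f true u) \in staircase m) /\
    (forall b u v, (f b u <= f b v) = (r b u <= r b v)).
Proof.
move=> m_gt0 cardT r_inj no321.
have [D [D0 Dnext]] := initial_chain_exists m r_inj no321.
exists (coord m r D); split=> [u|b u v]; first exact: coord_mem.
have mono := @coord_mono _ _ _ m_gt0 cardT r_inj _ D0 Dnext b.
have [lt|gt|/r_inj->] := ltngtP (r b u) (r b v); last by rewrite leqnn.
- by rewrite ltnW ?mono.
by rewrite leqNgt mono.
Qed.

(** * The padded point set and its size *)

Section PointSet.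
Local Open Scope nat_scope.

Lemma square_ge_exists n : exists k, n <= k * k.
Proof. by exists n; case: n => // n; rewrite leq_pmulr. Qed.

Definition ceil_sqrt n := ex_minn (square_ge_exists n).

Lemma ceil_sqrt_ge n : n <= ceil_sqrt n * ceil_sqrt n.
Proof. by rewrite /ceil_sqrt; case: ex_minnP. Qed.

Lemma ceil_sqrt_pred n k : ceil_sqrt n = k.+1 -> k * k < n.
Proof.
rewrite /ceil_sqrt; case: ex_minnP => j _ jmin ejk.
by rewrite ltnNge; apply/negP => /jmin; rewrite ejk ltnn.
Qed.

(* The staircase, shifted one unit to the right, padded with points on the
   vertical axis up to the size 22 m ^ 3 + n. *)
Definition point_seq n : seq (nat * nat) :=
  let V := [seq (p.1.+1, p.2) | p <- undup (staircase (ceil_sqrt n))] in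
  let m := ceil_sqrt n in
  V ++ [seq (0, i) | i <- iota 0 (22 * (m * (m * m)) + n - size V)].

Lemma point_seq_uniq n : uniq (point_seq n).
Proof.
rewrite cat_uniq map_inj_uniq ?undup_uniq; last by move=> [a b] [c d] /= [-> ->].
rewrite map_inj_uniq ?iota_uniq ?andbT; last by move=> a b [].
by apply/hasPn => _ /mapP[i _ ->]; apply/negP => /mapP[p _ []].
Qed.

Lemma size_point_seq n :
  size (point_seq n) = 22 * (ceil_sqrt n * (ceil_sqrt n * ceil_sqrt n)) + n.
Proof.
rewrite size_cat [size [seq (0, _) | _ <- _]]size_map size_iota size_map; set V := undup _.
(* This bound makes the truncated subtraction in [point_seq] exact. *)
have : size V <= 20 * (ceil_sqrt n * (ceil_sqrt n * ceil_sqrt n)).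
  exact: leq_trans (size_undup _) (size_staircase _).
by move=> le_V; rewrite subnKC //; apply: leq_trans le_V _; lia.
Qed.

End PointSet.

Local Open Scope ring_scope.

(** With s = sqrt n and m = [ceil_sqrt n], s <= m <= s + 1, so the difference 22 (m ^ 3 - s ^ 3) + n
    is at least n and at most 22 (3 s ^ 2 + 3 s + 1) + n, which is at most (22 * 7 + 1) n as 1 <=
    s. *)
Lemma size_point_seq_bounds (R : realType) (n : nat) (x := n%:R : R) : (0 < n)%N ->
  1 * x <= (size (point_seq n))%:R - 22 * (x * Num.sqrt x) <= 155 * x.
Proof.
move=> n_gt0; rewrite {}/x size_point_seq; case E: (ceil_sqrt n) => [|k].
  by have := ceil_sqrt_ge n; rewrite E leqNgt n_gt0.
have kn := ceil_sqrt_pred E; have := ceil_sqrt_ge n; rewrite {}E => nk.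
set s : R := Num.sqrt n%:R.
have s0 : 0 <= s by apply: sqrtr_ge0.
have sn : n%:R = s * s by rewrite -expr2 sqr_sqrtr.
have s1 : 1 <= s by rewrite -sqrtr1 ler_wsqrtr // ler1n.
have sk : s <= k%:R + 1.
  rewrite -(ler_pXn2r (n := 2)) ?nnegrE ?addr_ge0 // !expr2 -sn.
  by rewrite natr1 -natrM ler_nat.
have ks : k%:R <= s.
  by rewrite -(ler_pXn2r (n := 2)) ?nnegrE // !expr2 -sn -natrM ler_nat ltnW.
rewrite natrD !natrM -[k.+1%:R]natr1 sn; move: (k%:R : R) sk ks (ler0n R k) => x sk ks x0.
have lo : s * (s * s) <= (x + 1) * ((x + 1) * (x + 1)).
  by rewrite !ler_pM ?mulr_ge0.
have hi : (x + 1) * ((x + 1) * (x + 1)) <= (s + 1) * ((s + 1) * (s + 1)).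
  by rewrite !ler_pM ?mulr_ge0 ?lerD2r ?addr_ge0.
have ss : s <= s * s by rewrite ler_peMl.
apply/andP; split; lra.
Qed.

Theorem theorem14 (R : realType) :
  exists U : nat -> seq (R * R),
    (forall n, uniq (U n)) /\
    (exists (c1 c2 : R) (N : nat), 0 < c1 /\ 0 < c2 /\
       forall n : nat, (N <= n)%N ->
         c1 * n%:R <= (size (U n))%:R - 22 * (n%:R * Num.sqrt n%:R) <= c2 * n%:R) /\
    (forall (n : nat) (T : finType) (le : rel T),
       #|T| = n -> is_partial_order le -> width le = 2%N ->
       exists f : T -> R * R,
         injective f /\ (forall a, f a \in U n) /\
         (forall a b, le a b <-> dominated (f a) (f b))).
Proof.
pose emb (p : nat * nat) : R * R := (p.1%:R, p.2%:R).
have emb_inj : injective emb.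
  by move=> [a b] [c d] [/eqP]; rewrite eqr_nat => /eqP-> /eqP; rewrite eqr_nat => /eqP->.
exists (fun n => map emb (point_seq n)); split; last split.
- by move=> n; rewrite map_inj_uniq ?point_seq_uniq.
- exists 1, 155, 1%N; split=> //; split=> // n n_gt0.
  by rewrite size_map size_point_seq_bounds.
move=> n T le cardT [le_refl [le_anti le_trans]] width2.
have cmp3 a b c : [|| cmp le a b, cmp le a c | cmp le b c].
  apply/negPn/negP => /norP[ab /norP[ac bc]].
  have neq x y : ~~ cmp le x y -> x != y.
    by apply: contraNneq => ->; rewrite /cmp le_refl.
  have : (#|[set a; b; c]| <= width le)%N.
    apply: (@leq_bigmax_cond _ _ (fun S : {set T} => #|S|)).
    apply/forall_inP => x xS; apply/forall_inP => y yS; apply/implyP => xy.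
    rewrite -negb_or -/(cmp le x y); move: xS yS xy; rewrite !inE.
    by case/orP=> [/orP[]|] /eqP->; case/orP=> [/orP[]|] /eqP->; rewrite ?eqxx // => _;
      rewrite // cmpC.
  by rewrite width2 setUC !cardsU1 cards1 !inE !(eq_sym c) negb_or !neq.
have [r [r_inj leE]] := realizer le_refl le_anti le_trans cmp3.
have n_gt0 : (0 < n)%N.
  rewrite lt0n; apply/eqP => n0; move: width2; rewrite /width.
  suff : (\max_(S : {set T} | antichain le S) #|S| <= 0)%N by move=> + e; rewrite e.
  by apply/bigmax_leqP => S _; rewrite -n0 -cardT max_card.
have m_gt0 : (0 < ceil_sqrt n)%N.
  by have := ceil_sqrt_ge n; case: (ceil_sqrt n) => //; rewrite leqNgt n_gt0.
have [||f [fU fE]] := @staircase_universal T (ceil_sqrt n) r m_gt0 _ r_inj.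
- by rewrite cardT ceil_sqrt_ge.
- move=> c u v w uv vw wv vu.
  (* Elements ranked oppositely are incomparable, so the excluded pattern would be a three-element
     antichain. *)
  have incomp x y : (r c x < r c y -> r (~~ c) y < r (~~ c) x -> ~~ cmp le x y)%N.
    move=> xy yx; rewrite /cmp !leE.
    by case: (c) xy yx => /=; rewrite ltnNge => /negbTE xy; rewrite ltnNge => /negbTE yx;
      rewrite xy yx ?andbF.
  have := cmp3 u v w; rewrite (negbTE (incomp _ _ uv vu)) (negbTE (incomp _ _ vw wv)).
  by rewrite (negbTE (incomp _ _ (ltn_trans uv vw) (ltn_trans wv vu))).
exists (fun a => emb ((f false a).+1, f true a)); split; last split.
- move=> a b /emb_inj[_ e]; apply: (r_inj true).
  by apply/eqP; rewrite eqn_leq -!fE e leqnn.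
- move=> a; apply/map_f; rewrite mem_cat; apply/orP; left.
  by apply/mapP; exists (f false a, f true a); rewrite ?mem_undup.
(* The ranking [true] gives the ordinate, hence the swap of the two conjuncts. *)
move=> a b; rewrite leE -!fE /dominated /= !ler_nat ltnS andbC.
by split.
Qed.
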